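(* Let $A\in\mathbb{C}^{n\times n}$ have index $k$ with $r(A^k)=t$, and let $m$ be a positive integer. Let $B\in\mathbb{C}^{n\times(n-t)}$ and $C^*\in\mathbb{C}^{n\times(n-t)}$ be of full column rank such that $\mathcal{R}(B)=\mathcal{N}((A^k)^*A^{m+1}A^\dagger)$ and $\mathcal{N}(C)=\mathcal{R}(A^k)$. Let $D\in\mathbb{C}^{q\times n}$ satisfy $\mathcal{N}(D)\supseteq\mathcal{N}((A^k)^*A^{m+1})$. Then the unique solution $X\in\mathbb{C}^{q\times n}$ of the restricted matrix equation $$XA=D,\qquad \mathcal{N}(X)\supseteq\mathcal{N}((A^k)^*A^{m+1}A^\dagger)$$ is given by $X=[x_{ij}]$, where $$x_{ij}=\frac{\det\begin{bmatrix}A(d_i\leftarrow j)&B(0\leftarrow j)\\C&0\end{bmatrix}}{\det\begin{bmatrix}A&B\\C&0\end{bmatrix}},\qquad i=1,\dots,q,\ j=1,\dots,n,$$ where $d_i$ denotes the $i$-th row of $D$, and $A(d_i\leftarrow j)$ and $B(0\leftarrow j)$ denote the matrices obtained from $A$ and $B$ by replacing their $j$-th rows by $d_i$ and $0$, respectively.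
   Context: $r(\cdot)$, $\mathcal{R}(\cdot)$, $\mathcal{N}(\cdot)$, $(\cdot)^*$ denote rank, range, null space and conjugate transpose; $A^\dagger$ is the Moore-Penrose inverse. The index of $A\in\mathbb{C}^{n\times n}$ is the smallest nonnegative integer $k$ with $r(A^{k+1})=r(A^k)$ (with $A^0=I_n$). *)

(* Defs.v *)
From mathcomp Require Import all_boot all_order all_algebra.

Set Implicit Arguments.
Unset Strict Implicit.
Unset Printing Implicit Defensive.

Import Order.TTheory GRing.Theory Num.Theory.

Local Open Scope ring_scope.
Local Open Scope sesquilinear_scope.

(* MathComp's matrix spaces are row spaces; here matrices act on column
   vectors, so [colrange M] = {M v} and [nullspace M] = {v | M v = 0}. *)
Section RangeNull.
Variables (F : fieldType) (m n : nat).

Definition colrange (M : 'M[F]_(m, n)) : {vspace 'cV[F]_m} :=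
  limg (linfun (mulmx M : 'cV[F]_n -> 'cV[F]_m)).

Definition nullspace (M : 'M[F]_(m, n)) : {vspace 'cV[F]_n} :=
  lker (linfun (mulmx M : 'cV[F]_n -> 'cV[F]_m)).

Lemma colrangeP (M : 'M[F]_(m, n)) (w : 'cV[F]_m) :
  reflect (exists v : 'cV[F]_n, w = M *m v) (w \in colrange M).
Proof.
apply: (iffP memv_imgP) => [[v _ ->]|[v ->]]; exists v; rewrite ?lfunE //=.
exact: memvf.
Qed.

Lemma nullspaceP (M : 'M[F]_(m, n)) (v : 'cV[F]_n) :
  reflect (M *m v = 0) (v \in nullspace M).
Proof. by rewrite memv_ker lfunE; apply: eqP. Qed.

End RangeNull.

Section Index.
Variables (F : fieldType) (n : nat).

Lemma mxindex_exists (A : 'M[F]_n) :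
  exists k, \rank (A ^+ k.+1) == \rank (A ^+ k).
Proof.
case: (pickP (fun k : 'I_n.+1 => \rank (A ^+ k.+1) == \rank (A ^+ k))).
  by move=> k hk; exists k.
move=> noeq; suff: (\rank (A ^+ n.+1) + n.+1 <= n)%N.
  by rewrite addnS ltnNge leq_addl.
suff H k : (k <= n.+1)%N -> (\rank (A ^+ k) + k <= n)%N by exact: H.
elim: k => [|k IH] kn; first by rewrite addn0 rank_leq_row.
rewrite addnS; apply: leq_trans (IH (ltnW kn)).
rewrite ltn_add2r ltn_neqAle (noeq (Ordinal kn)) exprS; exact: mxrankM_maxr.
Qed.

Definition mxindex (A : 'M[F]_n) : nat := ex_minn (mxindex_exists A).

End Index.

Section MoorePenrose.
Variable C : numClosedFieldType.

Definition is_mpinv m n (A : 'M[C]_(m, n)) (X : 'M[C]_(n, m)) : bool :=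
  [&& A *m X *m A == A, X *m A *m X == X,
      (A *m X)^t* == A *m X & (X *m A)^t* == X *m A].

Lemma trmxC_mul m n p (A : 'M[C]_(m, n)) (B : 'M[C]_(n, p)) :
  (A *m B)^t* = B^t* *m A^t*.
Proof. by rewrite trmx_mul map_mxM. Qed.

Lemma gram_row_unit m n (G : 'M[C]_(m, n)) :
  row_free G -> G *m G^t* \in unitmx.
Proof.
move=> Gfree; rewrite -row_free_unit -kermx_eq0; apply/eqP/row_matrixP => i.
rewrite row0; set u := row i _.
have u0 : u *m (G *m G^t*) = 0 by rewrite -row_mul mulmx_ker row0.
have w0 : (u *m G) *m (u *m G)^t* = 0.
  by rewrite trmxC_mul mulmxA -(mulmxA u) u0 mul0mx.
apply: (row_free_inj Gfree); rewrite mul0mx; apply/rowP => j; rewrite [RHS]mxE.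
move/matrixP/(_ 0 0): w0; rewrite [LHS]mxE [RHS]mxE => /eqP.
rewrite psumr_eq0 => [/allP/(_ j)|l _]; last by rewrite !mxE mul_conjC_ge0.
rewrite mem_index_enum => /(_ isT); rewrite ![_^t* _ _]mxE /= [_^T _ _]mxE.
by rewrite mul_conjC_eq0 => /eqP.
Qed.

Lemma mpinv_exists m n (A : 'M[C]_(m, n)) : exists X, is_mpinv A X.
Proof.
have [r [F [G [Ffree Gfree ->]]]] : exists r (F : 'M[C]_(m, r)) (G : 'M_(r, n)),
    [/\ row_free (F^t*), row_free G & A = F *m G].
  exists (\rank A), (col_base A), (row_base A).
  split; [|exact: row_base_free|by rewrite mulmx_base].
  by rewrite /row_free mxrank_map mxrank_tr; apply: col_base_full.
have GU : G *m G^t* \in unitmx by apply: gram_row_unit.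
have FU : F^t* *m F \in unitmx by rewrite -{2}[F]trmxCK; apply: gram_row_unit.
pose P := invmx (G *m G^t*); pose Q := invmx (F^t* *m F).
have PC : P^t* = P by rewrite trmx_inv map_invmx trmxC_mul trmxCK.
have QC : Q^t* = Q by rewrite trmx_inv map_invmx trmxC_mul trmxCK.
pose X := G^t* *m P *m (Q *m F^t*).
have AX : F *m G *m X = F *m Q *m F^t*.
  by rewrite /X !mulmxA -(mulmxA F G) -(mulmxA F (G *m _)) mulmxV // mulmx1.
have XA : X *m (F *m G) = G^t* *m P *m G.
  by rewrite /X !mulmxA -(mulmxA _ (F^t*) F) mulmxKV.
exists X; apply/and4P; split; apply/eqP.
- by rewrite AX mulmxA -(mulmxA _ (F^t*) F) mulmxKV.
- by rewrite XA /X !mulmxA -(mulmxA _ G (G^t*)) mulmxKV.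
- by rewrite AX !trmxC_mul trmxCK QC mulmxA.
- by rewrite XA !trmxC_mul trmxCK PC mulmxA.
Qed.

Definition mpinv m n (A : 'M[C]_(m, n)) : 'M[C]_(n, m) :=
  xchoose (mpinv_exists A).

Lemma mpinvP m n (A : 'M[C]_(m, n)) : is_mpinv A (mpinv A).
Proof. exact: xchooseP. Qed.

Lemma mpinv_unique m n (A : 'M[C]_(m, n)) X : is_mpinv A X -> X = mpinv A.
Proof.
have := mpinvP A; move: (mpinv A) => Y.
move=> /and4P[/eqP Y1 /eqP Y2 /eqP Y3 /eqP Y4].
move=> /and4P[/eqP X1 /eqP X2 /eqP X3 /eqP X4].
have AXY : A *m X = A *m Y.
  by rewrite -[LHS]X3 -{1}Y1 -mulmxA trmxC_mul X3 Y3 mulmxA X1.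
have XAY : X *m A = Y *m A.
  by rewrite -[LHS]X4 -{1}Y1 -mulmxA mulmxA trmxC_mul X4 Y4 -mulmxA (mulmxA A) X1.
by rewrite -X2 -mulmxA AXY mulmxA XAY Y2.
Qed.

End MoorePenrose.

Definition row_replace (F : Type) m n (A : 'M[F]_(m, n)) (v : 'rV[F]_n)
    (j : 'I_m) : 'M[F]_(m, n) :=
  \matrix_(i, l) if i == j then v 0 l else A i l.

(* Main.v *)
Require Import Defs.
From mathcomp Require Import all_boot all_order all_algebra.
From mathcomp Require Import reals complex.

Set Implicit Arguments.
Unset Strict Implicit.
Unset Printing Implicit Defensive.

Import Order.TTheory GRing.Theory Num.Theory.
Local Open Scope ring_scope.
Local Open Scope sesquilinear_scope.
Local Open Scope complex_scope.

(** The idea. Write [P] for [A ^+ k], [H] for [P^t* *m A ^+ m.+1] and [G] for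
    [H *m mpinv A].  Then [G *m A = H], because [A *m mpinv A *m A = A].

    An inclusion of null spaces is a factorization on the left
    ([nullspace_subP]), so the restriction on [X] means [X = Y *m G] and the
    hypothesis on [D] means [D = Z *m H].  Hence [Z *m G] is a solution.

    The bordered matrix is nonsingular ([bordered_unitmx]).  Let [row_mx u w]
    annihilate it from the left.  From [u *m B = 0] one gets [u = y *m G], so
    that [y *m H + w *m C = 0].  Since [C *m P = 0], this gives
    [y *m P^t* *m A ^+ (m.+1 + k) = 0].  By the definition of the index [P]
    is [A ^+ (m.+1 + k) *m W] for some [W] ([expmx_index]), so
    [y *m P^t* *m P = 0], which forces [y *m P^t* = 0] by positivity of
    the hermitian product ([mul_gram_eq0]).  Hence [u = 0], then [w *m C = 0],
    and [w = 0] because the rows of [C] are independent.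

    Finally any solution [X] satisfies [X *m B = 0], since the range of [B] is
    the null space of [G].  So each row of [row_mx X 0] solves a square linear
    system whose matrix is the bordered one, with right-hand side the matching
    row of [row_mx D 0]; Cramer's rule on these rows ([cramer_row]) is the
    announced formula, and it leaves no room for a second solution. *)

Section Field.
Variable F : fieldType.

Lemma mulmx_delta_eq0 m n (M : 'M[F]_(m, n)) :
  (forall j, M *m delta_mx j 0 = 0 :> 'cV_m) -> M = 0.
Proof.
by move=> M0; apply/matrixP => i j; have /colP/(_ i) := M0 j; rewrite -colE !mxE.
Qed.

(** The columns of [cokermx G] span the null space of [G], and [X] is a left
    multiple of [G] exactly when it kills [cokermx G]. *)
Lemma nullspace_subP p q n (G : 'M[F]_(p, n)) (X : 'M[F]_(q, n)) :
  reflect (exists Y, X = Y *m G) (nullspace G <= nullspace X)%VS.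
Proof.
apply: (iffP subvP) => [sGX | [Y ->] v /nullspaceP Gv0]; last first.
  by apply/nullspaceP; rewrite -mulmxA Gv0 mulmx0.
apply/submxP; rewrite submxE; apply/eqP/mulmx_delta_eq0 => j.
rewrite -mulmxA; apply/nullspaceP/sGX/nullspaceP.
by rewrite mulmxA mulmx_coker mul0mx.
Qed.

Lemma mulmx_range_null m n p (C : 'M[F]_(m, n)) (P : 'M[F]_(n, p)) :
  (colrange P <= nullspace C)%VS -> C *m P = 0.
Proof.
move/subvP=> sPC; apply: mulmx_delta_eq0 => j.
rewrite -mulmxA; apply/nullspaceP/sPC/colrangeP.
by exists (delta_mx j 0).
Qed.

(** The ranges of the powers of [A] form a decreasing chain that becomes
    stationary at the index. *)
Lemma expmx_index n (A : 'M[F]_n) j :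
  exists Z, A ^+ mxindex A = A ^+ (j + mxindex A) *m Z.
Proof.
set k := mxindex A.
have /eqP rkA : \rank (A ^+ k.+1) == \rank (A ^+ k).
  by rewrite /k /mxindex; case: ex_minnP.
have [Z AZ] : exists Z, A ^+ k = A ^+ k.+1 *m Z.
  (* column spaces are row spaces of transposes; equal rank turns the
     inclusion of the range of the next power into an equality *)
  have sub : ((A ^+ k.+1)^T <= (A ^+ k)^T)%MS.
    by rewrite exprSr -mulmxE trmx_mul submxMl.
  have := mxrank_leqif_sup sub; rewrite !mxrank_tr rkA => -[_].
  rewrite eqxx => /esym/submxP[Z AZ]; exists Z^T.
  by apply: trmx_inj; rewrite trmx_mul trmxK.
elim: j => [|j [W AW]]; first by exists 1%:M; rewrite mulmx1.
exists (Z *m W); rewrite {1}AW exprD [in LHS]AZ addSnnS exprD.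
by rewrite -!mulmxE !mulmxA.
Qed.

Lemma det_row_replace n (M : 'M[F]_n) (b : 'rV[F]_n) j :
  \det (row_replace M b j) = (b *m \adj M) 0 j.
Proof.
rewrite (expand_det_row _ j) mxE; apply: eq_bigr => l _; rewrite !mxE eqxx.
congr (_ * (_ * \det _)); apply/matrixP => i i'.
by rewrite !mxE eq_sym (negbTE (neq_lift _ _)).
Qed.

(** With [b = x *m M], the product [b *m \adj M] is [\det M *: x]. *)
Lemma cramer_row n (M : 'M[F]_n) (x : 'rV[F]_n) j :
  \det M != 0 -> x 0 j = \det (row_replace M (x *m M) j) / \det M.
Proof.
move=> M0; rewrite det_row_replace -mulmxA mul_mx_adj mul_mx_scalar mxE.
by rewrite mulrC mulKf.
Qed.

Lemma row_replace_block m n p r (A : 'M[F]_(m, n)) (B : 'M[F]_(m, p))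
    (C : 'M[F]_(r, n)) (E : 'M[F]_(r, p)) a b j :
  block_mx (row_replace A a j) (row_replace B b j) C E =
  row_replace (block_mx A B C E) (row_mx a b) (lshift r j).
Proof.
apply/matrixP => i l; rewrite [RHS]mxE.
case: (split_ordP i) => i' ->; case: (split_ordP l) => l' ->;
  by rewrite !(block_mxEul, block_mxEur, block_mxEdl, block_mxEdr) ?eq_lshift
             ?eq_rlshift ?row_mxEl ?row_mxEr // mxE.
Qed.

End Field.

Section Bordered.
Variable F : numClosedFieldType.

(** If the row [y *m P^t*] were nonzero, its 1 x 1 Gram matrix would be
    invertible, but the hypothesis makes that matrix zero. *)
Lemma mul_gram_eq0 n p (P : 'M[F]_(n, p)) (y : 'rV[F]_p) :
  y *m P^t* *m P = 0 -> y *m P^t* = 0.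
Proof.
move=> y0; apply/eqP; apply: contraT => w0.
have /gram_row_unit : row_free (y *m P^t*) by rewrite /row_free rank_rV w0.
by rewrite trmxC_mul trmxCK mulmxA y0 mul0mx unitmxE det0 unitr0.
Qed.

Lemma mulmx_mpinvK p n (A : 'M[F]_n) (M : 'M[F]_(p, n)) :
  M *m A *m mpinv A *m A = M *m A.
Proof.
by have /and4P[/eqP AXA _ _ _] := mpinvP A; rewrite -!mulmxA (mulmxA A) AXA.
Qed.

(** A row [row_mx u w] in the left kernel has [u] in the row space of [G]; the
    stabilization of the powers of [A] confines the row space of [H] and that
    of [C] to a trivial intersection, which kills [u] and then [w]. *)
Lemma bordered_unitmx n p m (A : 'M[F]_n) (B : 'M[F]_(n, p)) (C : 'M[F]_(p, n)) :
  let P := A ^+ mxindex A in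
  row_free C ->
  (nullspace (P^t* *m A ^+ m.+1 *m mpinv A) <= colrange B)%VS ->
  (colrange P <= nullspace C)%VS ->
  block_mx A B C 0 \in unitmx.
Proof.
move=> P freeC sGB /mulmx_range_null CP0.
rewrite -row_free_unit; apply/inj_row_free => v.
rewrite -[v]hsubmxK; set u := lsubmx v; set w := rsubmx v.
rewrite mul_row_block mulmx0 addr0 -row_mx0.
case/eq_row_mx => uAwC uB0.
have [y uE] : exists y, u = y *m (P^t* *m A ^+ m.+1 *m mpinv A).
  apply/nullspace_subP/(subv_trans sGB)/subvP => _ /colrangeP[x ->].
  by apply/nullspaceP; rewrite mulmxA uB0 mul0mx.
have uAE : u *m A = y *m P^t* *m A ^+ m.+1.
  by rewrite uE exprSr -mulmxE !mulmxA mulmx_mpinvK.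
have yP0 : y *m P^t* = 0.
  apply: mul_gram_eq0; have [Z] := expmx_index A m.+1; rewrite -/P => PZ.
  (* multiplying by [P] kills the [C] term; by [PZ], multiplying by [Z] then
     turns the remaining power of [A] into [P] *)
  have := congr1 (mulmx^~ (P *m Z)) uAwC.
  rewrite /= mul0mx mulmxDl (mulmxA (w *m C)) -(mulmxA w) CP0 mulmx0 mul0mx.
  by rewrite addr0 uAE => <-; rewrite {2}PZ exprD -mulmxE !mulmxA.
have u0 : u = 0 by rewrite uE !mulmxA yP0 !mul0mx.
have w0 : w = 0.
  by apply: (row_free_inj freeC); rewrite mul0mx -uAwC u0 mul0mx add0r.
by rewrite u0 w0.
Qed.

(** [Z *m G] solves the restricted equation, and [cramer] shows that every
    solution equals the matrix of quotients; this is at once the formula and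
    the uniqueness. *)
Theorem restricted_equation_cramer n p q m (A : 'M[F]_n) (B : 'M[F]_(n, p))
    (C : 'M[F]_(p, n)) (D : 'M[F]_(q, n)) :
  let P := A ^+ mxindex A in
  let G := P^t* *m A ^+ m.+1 *m mpinv A in
  row_free C ->
  colrange B = nullspace G ->
  (colrange P <= nullspace C)%VS ->
  (nullspace (P^t* *m A ^+ m.+1) <= nullspace D)%VS ->
  \det (block_mx A B C 0) != 0 /\
  unique (fun X => X *m A = D /\ (nullspace G <= nullspace X)%VS)
    (\matrix_(i < q, j < n)
       (\det (block_mx (row_replace A (row i D) j) (row_replace B 0 j) C 0)
        / \det (block_mx A B C 0))).
Proof.
move=> P G freeC rB nC sHD.
have M0 : \det (block_mx A B C 0) != 0.
  rewrite -unitfE -unitmxE; apply: (@bordered_unitmx _ _ m) => //.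
  by rewrite rB.
split=> //.
have GA : G *m A = P^t* *m A ^+ m.+1.
  by rewrite /G exprSr -mulmxE !mulmxA mulmx_mpinvK.
have [Z DE] := nullspace_subP _ _ sHD.
have cramer X : X *m A = D -> (nullspace G <= nullspace X)%VS ->
    \matrix_(i < q, j < n)
      (\det (block_mx (row_replace A (row i D) j) (row_replace B 0 j) C 0)
       / \det (block_mx A B C 0)) = X.
  move=> XA sGX; have XB : X *m B = 0 by apply: mulmx_range_null; rewrite rB.
  apply/matrixP => i j; rewrite mxE row_replace_block.
  have -> : row_mx (row i D) 0 = row_mx (row i X) 0 *m block_mx A B C 0.
    by rewrite mul_row_block !mul0mx !addr0 -!row_mul XA XB row0.
  by rewrite -cramer_row // row_mxEl mxE.
have XA : Z *m G *m A = D by rewrite -mulmxA GA DE.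
have sGX : (nullspace G <= nullspace (Z *m G))%VS.
  by apply/nullspace_subP; exists Z.
split=> [|X [XA' sGX']]; last exact: cramer.
by rewrite (cramer _ XA sGX).
Qed.

End Bordered.

Theorem theorem6p3 (R : realType) (n q k t m : nat)
    (A : 'M[R[i]]_n) (B : 'M[R[i]]_(n, n - t)) (C : 'M[R[i]]_(n - t, n))
    (D : 'M[R[i]]_(q, n)) :
  mxindex A = k ->
  \rank (A ^+ k) = t ->
  (0 < m)%N ->
  \rank B = (n - t)%N ->
  \rank (C^t*) = (n - t)%N ->
  colrange B = nullspace ((A ^+ k)^t* *m A ^+ m.+1 *m mpinv A) ->
  nullspace C = colrange (A ^+ k) ->
  (nullspace ((A ^+ k)^t* *m A ^+ m.+1) <= nullspace D)%VS ->
  \det (block_mx A B C 0) != 0 /\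
  unique
    (fun X : 'M[R[i]]_(q, n) =>
       X *m A = D /\
       (nullspace ((A ^+ k)^t* *m A ^+ m.+1 *m mpinv A) <= nullspace X)%VS)
    (\matrix_(i < q, j < n)
       (\det (block_mx (row_replace A (row i D) j) (row_replace B 0 j) C 0)
        / \det (block_mx A B C 0))).
Proof.
move=> <- _ _ _ rkC rB nC sHD.
have freeC : row_free C by move: rkC; rewrite mxrank_map mxrank_tr => /eqP.
by apply: restricted_equation_cramer; rewrite ?nC.
Qed.
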